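(* Let $\Sigma$ be a ranked alphabet and $k\ge1$. For every (nondeterministic) $k$-head tree-walking automaton with nested pebbles $\mathcal A$ over $\Sigma$ there is a closed formula $\phi$ of FO+TC$^k$ over $\Sigma$ with $L(\mathcal A)=\{t\in T_\Sigma\mid t\models\phi\}$. That is, $\mathrm{NPTWA}^k\subseteq\mathrm{FO{+}TC}^k$.
   Context: Trees: a ranked alphabet is a finite set $\Sigma$ with a map $\mathrm{rank}:\Sigma\to\mathbb{N}$; $T_\Sigma$ is the set of trees over $\Sigma$, a node labelled $\sigma$ having exactly $\mathrm{rank}(\sigma)$ children numbered $1,\dots,\mathrm{rank}(\sigma)$ (the root has child number $0$). Logic: first-order logic over $\Sigma$ has node variables, atomic formulas $\mathrm{lab}_\sigma(x)$, $\mathrm{edg}_i(x,y)$ ($y$ is the $i$-th child of $x$), $x\le y$ ($x$ is an ancestor of $y$), $x=y$, closed under $\neg,\wedge,\vee,\exists,\forall$. FO+TC$^k$ adds $k$-ary transitive closure: for a formula $\phi$ with $k$-tuples $\bar x,\bar y$ of distinct free variables (other free variables fixed), $t\models\phi^*(\bar u,\bar v)$ iff there are $k$-tuples of nodes $\bar u_0=\bar u,\dots,\bar u_n=\bar v$ ($n\ge0$) with $t\models\phi(\bar u_i,\bar u_{i+1})$ for all $i<n$. Automata: a $k$-head tree-walking automaton with nested pebbles is $\mathcal A=(Q,\Sigma,X,q_0,A,I)$: finite states $Q$, finite pebble set $X$, initial state $q_0$, accepting states $A$, finite set $I$ of instructions $\langle p,\chi,q\rangle$ with $\chi$ one of $\mathrm{up}_i$,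 $\mathrm{down}_{i,j}$, $\mathrm{drop}_i(x)$, $\mathrm{retrieve}(x)$, $\mathrm{lab}_{i,\sigma}$, $\mathrm{peb}_i(x)$, $\mathrm{chno}_{i,j}$ or a negated test $\neg\mathrm{lab}_{i,\sigma}$, $\neg\mathrm{peb}_i(x)$, $\neg\mathrm{chno}_{i,j}$ ($1\le i\le k$ a head, $x\in X$). Configurations: $[p,\bar u,\alpha]$ with state, $k$-tuple of head nodes, stack $\alpha$ of (pebble,node) pairs. Semantics: $\mathrm{up}_i$/$\mathrm{down}_{i,j}$ move head $i$ to the parent/$j$-th child; $\mathrm{drop}_i(x)$ pushes $(x,u[i])$ if $x$ is not on the stack; $\mathrm{retrieve}(x)$ pops the top pair if its pebble is $x$, regardless of head positions; tests check the label of $u[i]$, presence of $(x,u[i])$ on the stack, or child number of $u[i]$ (negated tests succeed iff the test fails) and change nothing. A configuration is halting if no instruction applies. $t\in L(\mathcal A)$ iff from $[q_0,\overline{\mathrm{root}},\varepsilon]$ some halting configuration $[p,\overline{\mathrm{root}},\varepsilon]$ with $p\in A$ is reachable. $\mathrm{NPTWA}^k$ is the family of languages accepted by such automata. *)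

(* Defs.v *)
From Stdlib Require Import Relations.
From Stdlib Require List.
From mathcomp Require Import all_boot.

Set Implicit Arguments.
Unset Strict Implicit.
Unset Printing Implicit Defensive.

Record rankedAlphabet := RankedAlphabet {
  symbol :> finType;
  rank : symbol -> nat
}.

Inductive tree (S : rankedAlphabet) : Type :=
  Node (s : S) (c : {ffun 'I_(rank s) -> tree S}).

Section Nodes.
Variable S : rankedAlphabet.
Implicit Types (t : tree S) (p : seq nat).

(* Nodes are addressed by the sequence of child numbers (1, ..., rank) on the
   path leading from the root to the node. *)
Fixpoint subtree t p {struct p} : option (tree S) :=
  match p with
  | [::] => Some t
  | j :: p' =>
      let: Node s c := t in
      if j is j'.+1 then
        if insub j' is Some i then subtree (c i) p' else None
      else None
  end.

Definition node t : Type := {p : seq nat | isSome (subtree t p)}.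

Definition root_node t : node t := exist _ [::] isT.

Definition has_label t (s : S) (u : node t) : bool :=
  if subtree t (val u) is Some (Node s' _) then s' == s else false.

Definition is_child t (j : nat) (u v : node t) : bool :=
  val v == rcons (val u) j.

Definition ancestor t (u v : node t) : bool := prefix (val u) (val v).

(* The child number of the root is 0. *)
Definition chno t (u : node t) : nat := last 0 (val u).

End Nodes.

Definition var := nat.

Inductive formula (S : rankedAlphabet) (k : nat) : Type :=
  | FLab of S & var
  | FEdg of nat & var & var
  | FLe of var & var
  | FEq of var & var
  | FNot of formula S k
  | FAnd of formula S k & formula S k
  | FOr of formula S k & formula S k
  | FEx of var & formula S k
  | FAll of var & formula S k
  | FTC (x y : k.-tuple var) of uniq (x ++ y) & formula S k &
        k.-tuple var & k.-tuple var.

(* A variable z that is not in xs keeps its value e z, because index z xs is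
   then out of the bounds of us (whenever size us = size xs). *)
Definition assign (T : Type) (e : var -> T) (xs : seq var) (us : seq T) :
    var -> T :=
  fun z => nth (e z) us (index z xs).

Section Semantics.
Variables (S : rankedAlphabet) (k : nat).

Fixpoint free_vars (phi : formula S k) : seq var :=
  match phi with
  | FLab _ x => [:: x]
  | FEdg _ x y | FLe x y | FEq x y => [:: x; y]
  | FNot f => free_vars f
  | FAnd f g | FOr f g => free_vars f ++ free_vars g
  | FEx x f | FAll x f => [seq z <- free_vars f | z != x]
  | @FTC _ _ x y _ f u v =>
      [seq z <- free_vars f | z \notin x ++ y] ++ u ++ v
  end.

Definition closed_formula (phi : formula S k) : Prop := free_vars phi = [::].

Fixpoint sat (t : tree S) (e : var -> node t) (phi : formula S k) : Prop :=
  match phi with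
  | FLab s x => has_label s (e x)
  | FEdg j x y => is_child j (e x) (e y)
  | FLe x y => ancestor (e x) (e y)
  | FEq x y => e x = e y
  | FNot f => ~ sat e f
  | FAnd f g => sat e f /\ sat e g
  | FOr f g => sat e f \/ sat e g
  | FEx x f => exists u : node t, sat (assign e [:: x] [:: u]) f
  | FAll x f => forall u : node t, sat (assign e [:: x] [:: u]) f
  | @FTC _ _ x y _ f u v =>
      clos_refl_trans (k.-tuple (node t))
        (fun a b => sat (assign e (x ++ y) (a ++ b)) f)
        (map_tuple e u) (map_tuple e v)
  end.

(* Intended for closed formulas, whose truth does not depend on e. *)
Definition models (t : tree S) (phi : formula S k) : Prop :=
  forall e : var -> node t, sat e phi.

End Semantics.

Section Instructions.
Variables (S : rankedAlphabet) (k : nat) (X : Type).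

Inductive test : Type :=
  | TLab of 'I_k & S
  | TPeb of 'I_k & X
  | TChno of 'I_k & nat.

Inductive action : Type :=
  | Up of 'I_k
  | Down of 'I_k & nat
  | Drop of 'I_k & X
  | Retrieve of X
  | Pos of test
  | Neg of test.

End Instructions.

Record nptwa (S : rankedAlphabet) (k : nat) := NPTWA {
  state : finType;
  pebble : finType;
  init : state;
  accepting : {set state};
  instrs : seq (state * action S k pebble * state)
}.

Section Computations.
Variables (S : rankedAlphabet) (k : nat) (A : nptwa S k) (t : tree S).

Definition heads := k.-tuple (node t).

(* The top of the pebble stack is the first element of the sequence. *)
Definition stack := seq (pebble A * node t).

Record config := Config {
  cstate : state A;
  cheads : heads;
  cstack : stack
}.

Definition move (u : heads) (i : 'I_k) (w : node t) : heads :=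
  [tuple if j == i then w else tnth u j | j < k].

Definition holds (b : test S k (pebble A)) (u : heads) (al : stack) : bool :=
  match b with
  | TLab i s => has_label s (tnth u i)
  | TPeb i x => (x, tnth u i) \in al
  | TChno i j => chno (tnth u i) == j
  end.

Definition exec (a : action S k (pebble A)) (u : heads) (al : stack)
    (u' : heads) (al' : stack) : Prop :=
  match a with
  | Up i => exists w : node t,
      [/\ exists j, is_child j w (tnth u i), u' = move u i w & al' = al]
  | Down i j => exists w : node t,
      [/\ is_child j (tnth u i) w, u' = move u i w & al' = al]
  | Drop i x =>
      [/\ x \notin unzip1 al, u' = u & al' = (x, tnth u i) :: al]
  | Retrieve x => u' = u /\ exists w : node t, al = (x, w) :: al'
  | Pos b => [/\ holds b u al, u' = u & al' = al]
  | Neg b => [/\ ~~ holds b u al, u' = u & al' = al]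
  end.

Definition step (c c' : config) : Prop :=
  exists2 a, List.In (cstate c, a, cstate c') (instrs A) &
    exec a (cheads c) (cstack c) (cheads c') (cstack c').

Definition halting (c : config) : Prop := forall c', ~ step c c'.

Definition root_config (q : state A) : config :=
  Config q [tuple root_node t | _ < k] [::].

Definition accepts : Prop :=
  exists2 q, q \in accepting A &
    clos_refl_trans config step (root_config (init A)) (root_config q)
    /\ halting (root_config q).

End Computations.

(* Main.v *)
(* Kleene's construction removes the states: the computations from p to q whose
   intermediate states lie in a given list are defined from the one-step
   relations by union, composition and k-ary transitive closure.  Pebbles are
   removed by nesting: a computation that starts and ends with stack al and
   never digs into al is a sequence of macro steps, each one being either a
   move or test executed with stack al, or a whole excursion that drops a
   pebble x, computes with stack (x, _) :: al, and retrieves x.  As x is not in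
   al, induction on the number of pebbles not in al shows that these
   computations are definable, the position of each pebble in al being the
   value of one free variable. *)
Require Import Defs.
From Stdlib Require Import Relations Classical FunctionalExtensionality.
From Stdlib Require List.
From mathcomp Require Import all_boot zify.

Set Implicit Arguments.
Unset Strict Implicit.
Unset Printing Implicit Defensive.

Lemma mem_In (T : eqType) (x : T) (s : seq T) : x \in s -> List.In x s.
Proof.
elim: s => //= y s IHs; rewrite in_cons => /predU1P[->|/IHs]; first by left.
by right.
Qed.

Lemma clos_rt_equiv (T : Type) (R R' : relation T) :
  (forall x y, R x y <-> R' x y) ->
  forall x y, clos_refl_trans T R x y <-> clos_refl_trans T R' x y.
Proof.
move=> RR' x y; split; elim=> {x y} [x y /RR'|x|x y z _ xy _ yz].
- exact: rt_step.
- exact: rt_refl.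
- exact: rt_trans xy yz.
- exact: rt_step.
- exact: rt_refl.
- exact: rt_trans xy yz.
Qed.

(** * Kleene's elimination of states *)

Section Kleene.
Variables (Q : finType) (T : Type) (R : Q -> Q -> relation T).

(** Only nonempty computations count: the base case is a single step, and each state [m] put on the
    list allows any number of loops through [m]. *)
Fixpoint kleene (s : seq Q) (p q : Q) (u v : T) : Prop :=
  if s is m :: s' then
    kleene s' p q u v \/
    exists w, kleene s' p m u w /\
    exists w', clos_refl_trans T (kleene s' m m) w w' /\ kleene s' m q w' v
  else R p q u v.

Definition state_step (c d : Q * T) : Prop := R c.1 d.1 c.2 d.2.

Lemma kleene_incl s p q u v : R p q u v -> kleene s p q u v.
Proof. by move=> Ruv; elim: s => //= m s IHs; left. Qed.

(** If [m] heads the list, the meeting point becomes one more visit in the decomposition at [m].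
    Otherwise the two segments adjacent to it are joined by the induction hypothesis. *)
Lemma kleene_trans s m p q u v w :
  m \in s -> kleene s p m u v -> kleene s m q v w -> kleene s p q u w.
Proof.
elim: s m p q u v w => //= m' s IHs m p q u v w.
rewrite in_cons => /predU1P[->{m}|ms].
- move=> [Kuv|[a [Kua [b [Kab Kbv]]]]] [Kvw|[c [Kvc [d [Kcd Kdw]]]]]; right.
  + by exists v; split=> //; exists v; split=> //; apply: rt_refl.
  + exists v; split=> //; exists d; split=> //.
    by apply: rt_trans Kcd; apply: rt_step.
  + exists a; split=> //; exists v; split=> //.
    by apply: rt_trans Kab _; apply: rt_step.
  + exists a; split=> //; exists d; split=> //.
    apply: rt_trans Kab _; apply: rt_trans Kcd.
    by apply: (rt_trans _ _ _ v); apply: rt_step.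
- move=> [Kuv|[a [Kua [b [Kab Kbv]]]]] [Kvw|[c [Kvc [d [Kcd Kdw]]]]].
  + by left; apply: IHs Kuv Kvw.
  + right; exists c; split; first exact: IHs Kuv Kvc.
    by exists d.
  + right; exists a; split=> //; exists b; split=> //.
    exact: IHs Kbv Kvw.
  + right; exists a; split=> //; exists d; split=> //.
    apply: rt_trans Kab _; apply: rt_trans Kcd; apply: rt_step.
    exact: IHs Kbv Kvc.
Qed.

Lemma kleene_sound s p q u v :
  kleene s p q u v -> clos_refl_trans _ state_step (p, u) (q, v).
Proof.
elim: s p q u v => [|m s IHs] p q u v /=.
  by move=> Ruv; apply: rt_step.
case=> [/IHs //|[w [/IHs uw [w' [ww' /IHs w'v]]]]].
apply: rt_trans uw _; apply: rt_trans w'v.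
elim: ww' => {w w'} [w w' /IHs //|w|w w1 w2 _ ww1 _ w12].
- exact: rt_refl.
- exact: rt_trans ww1 w12.
Qed.

(** The empty computation is split off, as [kleene] takes at least one step; nonempty ones compose
    because [enum Q] contains every state. *)
Lemma kleeneP p q u v :
  clos_refl_trans _ state_step (p, u) (q, v) <->
  (p = q /\ u = v) \/ kleene (enum Q) p q u v.
Proof.
split=> [|[[-> ->]|]]; [|exact: rt_refl|exact: kleene_sound].
suff K c d : clos_refl_trans _ state_step c d ->
  (c.1 = d.1 /\ c.2 = d.2) \/ kleene (enum Q) c.1 d.1 c.2 d.2 by move/K.
elim=> {c d} [c d cd|c|c d f _ IHcd _ IHdf].
- by right; apply: kleene_incl.
- by left.
- case: IHcd IHdf => [[-> ->] //|Kcd] [[<- <-]|Kdf]; right=> //.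
  by apply: kleene_trans Kcd Kdf; rewrite mem_enum.
Qed.

End Kleene.

(** * Child numbers in terms of the child relation *)

Section Trees.
Variable S : rankedAlphabet.

Lemma subtree_rcons (t : tree S) p j :
  subtree t (rcons p j) ->
  subtree t p /\ 0 < j <= \max_(s : S) rank s.
Proof.
elim: p t => [|i p IHp] [s c] /=.
  case: j => // j; case: insubP => // i _ <- _; split=> //=.
  exact: leq_trans (ltn_ord i) (leq_bigmax s).
by case: i => // i; case: insubP => // i' _ _; apply: IHp.
Qed.

Variable t : tree S.
Implicit Types u v w : node t.

(** Turns the choice of a child number into a finite disjunction, which a formula can express. *)
Lemma is_child_bound j u v :
  is_child j u v -> 0 < j <= \max_(s : S) rank s.
Proof. by move/eqP=> vE; move: (valP v); rewrite vE => /subtree_rcons[]. Qed.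

Lemma chnoP u j :
  chno u = j <->
  if j is 0 then ~ (exists w i, is_child i w u) else exists w, is_child j w u.
Proof.
have parent p i : val u = rcons p i -> exists w, is_child i w u.
  move=> uE; have [pP _] : subtree t p /\ 0 < i <= \max_(s : S) rank s.
    by move: (valP u); rewrite uE => /subtree_rcons.
  by exists (exist _ p pP); apply/eqP.
rewrite /chno; have [p0 uE] : exists p0, val u = p0 by exists (val u).
rewrite uE; case: (lastP p0) uE => [|p i] uE {p0}.
- case: j => [|j]; split=> //.
    by move=> _ [w [i]]; rewrite /is_child uE; case: (val w).
  by case=> w; rewrite /is_child uE; case: (val w).
- have [w wu] := parent _ _ uE; rewrite last_rcons.
  have/andP[i_gt0 _] := is_child_bound wu.
  case: j => [|j]; split.
  + by move=> i0; rewrite i0 in i_gt0.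
  + by case; exists w, i.
  + by move=> <-; exists w.
  + by case=> w'; rewrite /is_child uE eqseq_rcons => /andP[_ /eqP].
Qed.

Lemma chno_root u : u = root_node t <-> chno u = 0.
Proof.
split=> [-> //|u0]; apply: val_inj; move: u0 (valP u); rewrite /chno.
by case: (lastP (val u)) => // p i; rewrite last_rcons => -> /subtree_rcons[].
Qed.

End Trees.

(** * Updating variable assignments *)

Section Assign.
Variables (T : Type) (e : var -> T).

Lemma assign_notin xs us z :
  size us = size xs -> z \notin xs -> assign e xs us z = e z.
Proof. by move=> us_xs z_xs; rewrite /assign nth_default ?us_xs ?memNindex. Qed.

Lemma map_assign xs us :
  uniq xs -> size us = size xs -> map (assign e xs us) xs = us.
Proof.
move=> xs_uniq us_xs; case: us us_xs => [|u0 us] us_xs.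
  by case: xs us_xs {xs_uniq}.
apply: (@eq_from_nth _ u0) => [|i]; rewrite size_map ?us_xs // => i_xs.
rewrite (nth_map 0) // /assign index_uniq //.
by apply: set_nth_default; rewrite us_xs.
Qed.

Lemma assign1 z u : assign e [:: z] [:: u] z = u.
Proof. by rewrite /assign /= eqxx. Qed.

End Assign.

Definition agree_off (T : Type) (zs : seq var) (e e' : var -> T) : Prop :=
  forall z, z \notin zs -> e' z = e z.

(** * Closure properties of definability *)

Section Definability.
Variables (S : rankedAlphabet) (k : nat).

(** Formulas stay hidden behind their meaning, so the translation manipulates predicates instead of
    syntax. *)
Definition definable (P : forall t : tree S, (var -> node t) -> Prop) : Prop :=
  exists phi : formula S k, forall t e, sat (t := t) e phi <-> P t e.

Lemma definable_iff P P' :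
  (forall t e, P t e <-> P' t e) -> definable P -> definable P'.
Proof.
by move=> PP' [phi phiP]; exists phi => t e; rewrite phiP; apply: PP'.
Qed.

Lemma definable_and P P' :
  definable P -> definable P' -> definable (fun t e => P t e /\ P' t e).
Proof.
by move=> [f fP] [g gP]; exists (FAnd f g) => t e /=; rewrite fP gP.
Qed.

Lemma definable_or P P' :
  definable P -> definable P' -> definable (fun t e => P t e \/ P' t e).
Proof.
by move=> [f fP] [g gP]; exists (FOr f g) => t e /=; rewrite fP gP.
Qed.

Lemma definable_not P : definable P -> definable (fun t e => ~ P t e).
Proof. by move=> [f fP]; exists (FNot f) => t e /=; rewrite fP. Qed.

(** Classical logic decides [B] once for all trees and assignments; this encodes facts about the
    automaton itself. *)
Lemma definable_const (B : Prop) : definable (fun _ _ => B).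
Proof.
case: (classic B) => hB; first by exists (FEq _ _ 0 0).
by exists (FNot (FEq _ _ 0 0)) => t e /=; split=> // /(_ erefl).
Qed.

Lemma definable_eq x y : definable (fun t e => e x = e y).
Proof. by exists (FEq _ _ x y). Qed.

Lemma definable_child j x y : definable (fun t e => is_child j (e x) (e y)).
Proof. by exists (FEdg _ _ j x y). Qed.

Lemma definable_label s x : definable (fun t e => has_label s (e x)).
Proof. by exists (FLab _ s x). Qed.

Lemma definable_exIn (T : Type) (l : seq T) P :
  (forall x, definable (P x)) ->
  definable (fun t e => exists2 x, List.In x l & P x t e).
Proof.
move=> Pdef; elim: l => [|y l IHl].
  by apply: definable_iff (definable_const False) => t e; split=> // -[].
apply: definable_iff (definable_or (Pdef y) IHl) => t e /=; split.
  by case=> [Py|[x xl Px]]; [exists y; [left|]|exists x; [right|]].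
by case=> x [<-|xl] Px; [left|right; exists x].
Qed.

Lemma definable_exfin (I : finType) P :
  (forall i : I, definable (P i)) -> definable (fun t e => exists i, P i t e).
Proof.
move/(definable_exIn (enum I)); apply: definable_iff => t e.
split=> [[i _ Pi]|[i Pi]]; first by exists i.
by exists i => //; apply: mem_In; rewrite mem_enum.
Qed.

Lemma definable_allfin (I : finType) P :
  (forall i : I, definable (P i)) -> definable (fun t e => forall i, P i t e).
Proof.
move=> Pdef.
have/definable_exfin/definable_not := fun i => definable_not (Pdef i).
apply: definable_iff => t e; split=> [nP i|P_ [i]]; last by apply.
by apply: NNPP => nPi; apply: nP; exists i.
Qed.

Lemma definable_ex zs P :
  definable P ->
  definable (fun t e => exists e', agree_off zs e e' /\ P t e').
Proof.
case=> phi phiP; exists (foldr (@FEx S k) phi zs) => t.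
elim: zs => [|z zs IHzs] e /=.
  rewrite phiP; split=> [Pe|[e' [ee' Pe']]]; first by exists e.
  by rewrite -(functional_extensionality _ _ (fun z => ee' z isT)).
split=> [[u /IHzs[e' [ee' Pe']]]|[e' [ee' Pe']]].
- exists e'; split=> // y; rewrite in_cons negb_or => /andP[yz yzs].
  by rewrite ee' // assign_notin // inE.
- exists (e' z); apply/IHzs; exists e'; split=> // y yzs.
  have [->|yz] := eqVneq y z; first by rewrite assign1.
  by rewrite assign_notin ?inE // ee' // in_cons negb_or yz.
Qed.

Lemma free_vars_foldr_FEx (zs : seq var) (phi : formula S k) :
  free_vars (foldr (@FEx S k) phi zs) = [seq z <- free_vars phi | z \notin zs].
Proof.
elim: zs => [|z zs IHzs] /=; first by rewrite filter_predT.
rewrite IHzs -filter_predI; apply: eq_filter => y /=.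
by rewrite in_cons negb_or.
Qed.

(** Closing existentially over all free variables keeps the meaning, since [B] ignores the
    assignment and every tree has a root to serve as witness. *)
Lemma definable_sentence (B : tree S -> Prop) :
  definable (fun t _ => B t) ->
  exists phi : formula S k, closed_formula phi /\ forall t, B t <-> models t phi.
Proof.
case=> phi phiP; exists (foldr (@FEx S k) phi (free_vars phi)); split.
  rewrite /closed_formula free_vars_foldr_FEx -[RHS](filter_pred0 (free_vars phi)).
  by apply: eq_in_filter => z ->.
move=> t; have exP zs (e : var -> node t) : sat e (foldr (@FEx S k) phi zs) <-> B t.
  elim: zs e => [|z zs IHzs] e /=; first exact: phiP.
  by split=> [[u /IHzs]|Bt] //; exists (root_node t); apply/IHzs.
by split=> [Bt e|/(_ (fun=> root_node t))/exP //]; apply/exP.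
Qed.

(* The heads before and after a computation are the values of the blocks of
   variables [block 0] and [block k]; [block (k + k)] serves for intermediate
   heads, [aux] is a scratch variable, and larger variables hold pebbles. *)
Definition block (n : nat) : k.-tuple var := [tuple of iota n k].
Definition aux : var := k + k + k.

Lemma block_map (t : tree S) (e : var -> node t) n i :
  tnth (map_tuple e (block n)) i = e (n + i).
Proof. by rewrite tnth_map (tnth_nth 0) nth_iota. Qed.

Lemma block_eqP (t : tree S) (e e' : var -> node t) n m :
  map_tuple e (block n) = map_tuple e' (block m) <->
  forall i : 'I_k, e (n + i) = e' (m + i).
Proof.
split=> [ee' i|ee']; first by rewrite -!block_map ee'.
by apply: eq_from_tnth => i; rewrite !block_map.
Qed.

Lemma block_assign (t : tree S) (e : var -> node t) n (u : k.-tuple (node t)) :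
  map_tuple (assign e (block n) u) (block n) = u.
Proof.
by apply: val_inj; rewrite /= map_assign ?iota_uniq ?size_tuple ?size_iota.
Qed.

Lemma agree_off_assign (t : tree S) (e : var -> node t) n (u : k.-tuple (node t)) :
  agree_off (block n) e (assign e (block n) u).
Proof. by move=> z zn; rewrite assign_notin // !size_tuple. Qed.

Lemma agree_off_block (t : tree S) (zs : seq var) (e e' : var -> node t) n :
  agree_off zs e e' -> (forall z, n <= z < n + k -> z \notin zs) ->
  map_tuple e' (block n) = map_tuple e (block n).
Proof.
move=> ee' nzs; apply/block_eqP => i; apply: ee'; apply: nzs.
by rewrite leq_addr ltn_add2l ltn_ord.
Qed.

Lemma definable_block_eq n m :
  definable (fun t e => map_tuple e (block n) = map_tuple e (block m)).
Proof.
have/definable_allfin := fun i : 'I_k => definable_eq (n + i) (m + i).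
by apply: definable_iff => t e; rewrite block_eqP.
Qed.

(** [aux] is bound to a candidate parent, so it must differ from [x]. For child number 0, parenthood
    is refuted for each of the finitely many possible child numbers. *)
Lemma definable_chno x j :
  x != aux -> definable (fun t e => chno (e x) = j).
Proof.
move=> x_aux; case: j => [|j].
- have/(definable_exIn (iota 1 (\max_(s : S) rank s))) :=
    fun j => definable_child j aux x.
  move/(definable_ex [:: aux])/definable_not; apply: definable_iff => t e.
  rewrite (chnoP _ 0); split=> nP [].
    move=> w [i wi]; apply: nP; exists (assign e [:: aux] [:: w]).
    split=> [z|]; first exact: assign_notin.
    exists i; last by rewrite assign1 assign_notin // inE.
    by apply: mem_In; rewrite mem_iota; have := is_child_bound wi; lia.
  move=> e' [ee' [i _ wi]]; apply: nP; exists (e' aux), i.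
  by rewrite -(ee' x) // inE.
- have/(definable_ex [:: aux]) := definable_child j.+1 aux x.
  apply: definable_iff => t e; rewrite (chnoP _ j.+1); split.
    by case=> e' [ee' wi]; exists (e' aux); rewrite -(ee' x) // inE.
  case=> w wi; exists (assign e [:: aux] [:: w]).
  split=> [z|]; first exact: assign_notin.
  by rewrite assign1 assign_notin // inE.
Qed.

(** * Relations between head tuples, with pebble positions as parameters *)

Variable X : finType.

(** Lies beyond the three blocks and [aux], so rebinding those never disturbs a pebble position. *)
Definition pvar (x : X) : var := aux.+1 + enum_rank x.

Lemma pvar_inj : injective pvar.
Proof. by move=> x y /addnI/ord_inj/enum_rank_inj. Qed.

Lemma pvar_ge x : k + k + k < pvar x.
Proof. by rewrite /pvar /aux leq_addr. Qed.

Definition definable_rel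
    (R : forall t : tree S, (X -> node t) -> relation (k.-tuple (node t))) :=
  definable (fun t e =>
    R t (e \o pvar) (map_tuple e (block 0)) (map_tuple e (block k))).

Lemma agree_off_pvar (t : tree S) (zs : seq var) (e e' : var -> node t) :
  agree_off zs e e' -> (forall z, aux < z -> z \notin zs) ->
  e' \o pvar = e \o pvar.
Proof.
by move=> ee' zsP; apply: functional_extensionality => x; apply/ee'/zsP/pvar_ge.
Qed.

(* Quantifying over a block that is first equated to another one replaces
   variable renaming. *)
Lemma definable_comp R R' :
  definable_rel R -> definable_rel R' ->
  definable_rel (fun t r u v => exists w, R t r u w /\ R' t r w v).
Proof.
move=> Rdef R'def.
have/(definable_ex (block k)) D1 :=
  definable_and (definable_block_eq k (k + k)) Rdef.
have/(definable_ex (block 0)) D2 :=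
  definable_and (definable_block_eq 0 (k + k)) R'def.
have := definable_ex (block (k + k)) (definable_and D1 D2).
apply: definable_iff => t e; split.
- case=> e1 [ee1 [[e2 [ee2 [E2 R2]]] [e3 [ee3 [E3 R3]]]]].
  exists (map_tuple e1 (block (k + k))).
  (* Each quantifier changes a single block, so pebbles and outer heads are read back in [e], and
     the middle heads in [e1]. *)
  move: R2 R3; rewrite E2 E3.
  rewrite (agree_off_pvar ee2) ?(agree_off_pvar ee3) ?(agree_off_pvar ee1);
    try by move=> z; rewrite mem_iota /aux; lia.
  rewrite (agree_off_block (n := 0) ee2) ?(agree_off_block (n := 0) ee1);
    try by move=> z; rewrite mem_iota; lia.
  rewrite (agree_off_block (n := k) ee3) ?(agree_off_block (n := k) ee1);
    try by move=> z; rewrite mem_iota; lia.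
  rewrite (agree_off_block (n := k + k) ee2) ?(agree_off_block (n := k + k) ee3);
    by [|move=> z; rewrite mem_iota; lia].
- case=> w [Ruw Rwv].
  have ee1 := agree_off_assign (n := k + k) e w.
  set e1 := assign _ _ _ in ee1; exists e1; split=> //.
  have e1w : map_tuple e1 (block (k + k)) = w by apply: block_assign.
  split.
  + have ee2 := agree_off_assign (n := k) e1 w.
    set e2 := assign _ _ _ in ee2; exists e2; split=> //.
    have e2w : map_tuple e2 (block k) = w by apply: block_assign.
    rewrite e2w (agree_off_block ee2) ?e1w;
      last by move=> z; rewrite mem_iota; lia.
    rewrite (agree_off_pvar ee2) ?(agree_off_pvar ee1);
      try by move=> z; rewrite mem_iota /aux; lia.
    by rewrite (agree_off_block (n := 0) ee2) ?(agree_off_block (n := 0) ee1);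
      try by move=> z; rewrite mem_iota; lia.
  + have ee2 := agree_off_assign (n := 0) e1 w.
    set e2 := assign _ _ _ in ee2; exists e2; split=> //.
    have e2w : map_tuple e2 (block 0) = w by apply: block_assign.
    rewrite e2w (agree_off_block ee2) ?e1w;
      last by move=> z; rewrite mem_iota; lia.
    rewrite (agree_off_pvar ee2) ?(agree_off_pvar ee1);
      try by move=> z; rewrite mem_iota /aux; lia.
    by rewrite (agree_off_block (n := k) ee2) ?(agree_off_block (n := k) ee1);
      try by move=> z; rewrite mem_iota; lia.
Qed.

Lemma uniq_blocks : uniq (block 0 ++ block k).
Proof. by rewrite -iotaD iota_uniq. Qed.

(** The two blocks serve both as the bound tuples and as the arguments of the closure operator;
    pebble variables lie outside them and stay fixed along the chain. *)
Lemma definable_star R :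
  definable_rel R ->
  definable_rel (fun t r => clos_refl_trans _ (R t r)).
Proof.
case=> phi phiP; exists (FTC uniq_blocks phi (block 0) (block k)) => t e /=.
apply: clos_rt_equiv => a b; rewrite phiP.
set e' := assign _ _ _.
have ee' : agree_off (block 0 ++ block k) e e'.
  by move=> z zP; rewrite /e' assign_notin // !size_cat !size_tuple.
rewrite (agree_off_pvar ee'); last first.
  by move=> z; rewrite mem_cat !mem_iota /aux; lia.
have : map e' (block 0 ++ block k) = a ++ b.
  by rewrite map_assign ?uniq_blocks // !size_cat !size_tuple.
rewrite map_cat => /eqP; rewrite eqseq_cat ?size_map ?size_tuple //.
case/andP=> /eqP E1 /eqP E2.
by rewrite (val_inj (E1 : val (map_tuple e' (block 0)) = _))
  (val_inj (E2 : val (map_tuple e' (block k)) = _)).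
Qed.

(** States become indices of formulas, so only the [k] heads are closed over: the loops at each [m]
    cost one closure of arity [k]. *)
Lemma definable_kleene (Q : finType)
    (R : forall t : tree S, (X -> node t) -> Q -> Q -> relation (k.-tuple (node t))) p q :
  (forall p q, definable_rel (fun t r => R t r p q)) ->
  definable_rel (fun t r u v =>
    clos_refl_trans _ (state_step (R t r)) (p, u) (q, v)).
Proof.
move=> Rdef.
have Kdef s : forall p q, definable_rel (fun t r => kleene (R t r) s p q).
  elim: s => [|m s IHs] p' q'; first exact: Rdef.
  exact: (definable_or (IHs p' q') (definable_comp (IHs p' m)
    (definable_comp (definable_star (IHs m m)) (IHs m q')))).
have/definable_or/(_ (Kdef (enum Q) p q)) :=
  definable_and (definable_const (p = q)) (definable_block_eq 0 k).
by apply: definable_iff => t e; rewrite kleeneP.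
Qed.

End Definability.

Section Automaton.
Variables (S : rankedAlphabet) (k : nat) (A : nptwa S k).

(** * Computations above a fixed bottom stack *)

Section Excursions.
Variable t : tree S.
Implicit Types (al : stack A t) (u v : heads k t) (c d : state A * heads k t).

(* The computations that start and end with stack [al] and during which [al]
   stays at the bottom of the stack. *)
Inductive excursion : stack A t -> relation (state A * heads k t) :=
  | Exc_refl al c : excursion al c c
  | Exc_exec al c p u a q v :
      excursion al c (p, u) -> List.In (p, a, q) (instrs A) ->
      exec a u al v al -> excursion al c (q, v)
  | Exc_drop al c p u p' i x q' v q :
      excursion al c (p, u) -> List.In (p, Drop _ i x, p') (instrs A) ->
      x \notin unzip1 al ->
      excursion ((x, tnth u i) :: al) (p', u) (q', v) ->
      List.In (q', Retrieve _ _ x, q) (instrs A) ->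
      excursion al c (q, v).

(** [d] and [r] are the matching drop and retrieve around an inner excursion; ranging over pairs of
    instructions gives a finite disjunction. *)
Definition bracket al (d r : state A * action S k (pebble A) * state A) u v :=
  match d.1.2, r.1.2 with
  | Drop i x, Retrieve y =>
      [/\ x = y, x \notin unzip1 al &
          excursion ((x, tnth u i) :: al) (d.2, u) (r.1.1, v)]
  | _, _ => False
  end.

Definition macro al (p q : state A) u v : Prop :=
  exists2 d, List.In d (instrs A) & d.1.1 = p /\
    ((d.2 = q /\ exec d.1.2 u al v al) \/
     exists2 r, List.In r (instrs A) & r.2 = q /\ bracket al d r u v).

(** Brings excursions into the form of Kleene's construction: steps indexed by pairs of states, with
    the stack as a fixed parameter. *)
Lemma excursionP al c d :
  excursion al c d <-> clos_refl_trans _ (state_step (macro al)) c d.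
Proof.
split.
- elim=> {al c d} [al c|al c p u a q v _ IH inst uv|].
  + exact: rt_refl.
  + apply: rt_trans IH _; apply: rt_step.
    by exists (p, a, q) => //; split=> //; left.
  + move=> al c p u p' i x q' v q _ IH drop_x x_al exc _ retr_x.
    apply: rt_trans IH _; apply: rt_step.
    exists (p, Drop _ i x, p') => //; split=> //; right.
    by exists (q', Retrieve _ _ x, q).
- move/clos_rt_rtn1_iff; elim=> {d} [|[p u] [q v] step_pq _ IH].
    exact: Exc_refl.
  case: step_pq => -[[p1 a] q1] inst [/= p1p]; rewrite {}p1p in inst.
  case=> [[q1q uv]|[[[q' b] q2] inst' [/= q2q br]]].
    by rewrite q1q in inst; apply: Exc_exec inst uv.
  rewrite {}q2q in inst'.
  move: inst inst' br; rewrite /bracket /=; case: a b => // i x [] // y.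
  move=> drop_x retr_x [xy x_al exc]; rewrite -xy in retr_x.
  exact: Exc_drop drop_x x_al exc retr_x.
Qed.

Lemma excursion_sound al c d :
  excursion al c d ->
  clos_refl_trans _ (@step _ _ A t)
    (Config c.1 c.2 al) (Config d.1 d.2 al).
Proof.
elim=> {al c d} [al c|al c p u a q v _ IH inst uv|].
- exact: rt_refl.
- by apply: rt_trans IH _; apply: rt_step; exists a.
- move=> al c p u p' i x q' v q _ IH drop_x x_al _ IHexc retr_x.
  apply: rt_trans IH _.
  apply: (rt_trans _ _ _ (Config p' u ((x, tnth u i) :: al))).
    by apply: rt_step; exists (Drop _ i x).
  apply: rt_trans IHexc _; apply: rt_step; exists (Retrieve _ _ x) => //=.
  by split=> //; exists (tnth u i).
Qed.

(* One excursion for each pebble on the stack, started when it was dropped. *)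
Fixpoint frames c0 al c : Prop :=
  if al is (x, w) :: al' then
    exists p u p' i,
      [/\ frames c0 al' (p, u), List.In (p, Drop _ i x, p') (instrs A),
          x \notin unzip1 al', w = tnth u i & excursion al (p', u) c]
  else excursion [::] c0 c.

Lemma frames_excursion c0 al p u q v :
  (forall c, excursion al c (p, u) -> excursion al c (q, v)) ->
  frames c0 al (p, u) -> frames c0 al (q, v).
Proof.
case: al => [|[x w] al] /= ext; first exact: ext.
case=> p1 [u1 [p2 [i [fr inst x_al wE exc]]]].
by exists p1, u1, p2, i; split=> //; apply: ext.
Qed.

(** A drop opens an empty excursion on top; a retrieve closes the top one, which extends the one
    below by [Exc_drop]; any other instruction extends the top one. *)
Lemma frames_step c0 (c c' : config A t) :
  step c c' -> frames c0 (cstack c) (cstate c, cheads c) ->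
  frames c0 (cstack c') (cstate c', cheads c').
Proof.
case: c c' => [p u al] [q v be] [a /= inst uv] fr.
have same_stack : be = al -> frames c0 be (q, v).
  move=> E; rewrite E in uv *; apply: frames_excursion fr => c exc.
  exact: Exc_exec exc inst uv.
case: a inst uv => [i|i j|i x|x|b|b] inst uv.
- by case: (uv) => w [_ _] /same_stack.
- by case: (uv) => w [_ _] /same_stack.
- case: uv => x_al -> ->; exists p, u, q, i; split=> //; exact: Exc_refl.
- case: uv {same_stack} => -> [w E]; rewrite {al}E in fr.
  case: fr => p1 [u1 [p2 [i [fr drop_x x_be wE exc]]]].
  rewrite {w}wE in exc; apply: frames_excursion fr => c exc1.
  exact: Exc_drop exc1 drop_x x_be exc inst.
- by case: (uv) => _ _ /same_stack.
- by case: (uv) => _ _ /same_stack.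
Qed.

(** The backward direction uses the invariant [frames], which on the empty stack is a single
    excursion. *)
Lemma excursion_nil p u q v :
  excursion [::] (p, u) (q, v) <->
  clos_refl_trans _ (@step _ _ A t) (Config p u [::]) (Config q v [::]).
Proof.
split=> [/excursion_sound //|/clos_rt_rtn1_iff].
suff fr (c : config A t) : clos_refl_trans_n1 _ (@step _ _ A t) (Config p u [::]) c ->
  frames (p, u) (cstack c) (cstate c, cheads c) by move/fr.
elim=> [|c1 c2 c12 _]; first exact: Exc_refl.
exact: frames_step.
Qed.

(** Applicability on the empty stack, where no pebble blocks a drop and none can be retrieved.
    Halting thus becomes a condition on state and heads. *)
Definition enabled (a : action S k (pebble A)) u : Prop :=
  match a with
  | Drop _ _ => True
  | Retrieve _ => False
  | _ => exists v, exec a u [::] v ([::] : stack A t)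
  end.

Lemma haltingP q u :
  halting (Config q u ([::] : stack A t)) <->
  ~ (exists2 d, List.In d (instrs A) & d.1.1 = q /\ enabled d.1.2 u).
Proof.
split=> [halt [[[p a] q'] inst [/= pq en]]|nen [q' v be] [a inst uv]].
- rewrite {p}pq in inst.
  have stuck v be : ~ exec a u [::] v be.
    by move=> uv; apply: (halt (Config q' v be)); exists a.
  case: a en stuck {inst} => //= [i|i j|i x|b|b].
  + by case=> v uv /(_ v [::]).
  + by case=> v uv /(_ v [::]).
  + by move=> _ /(_ u [:: (x, tnth u i)]); apply.
  + by case=> v uv /(_ v [::]).
  + by case=> v uv /(_ v [::]).
- apply: nen; exists (q, a, q') => //; split=> //=.
  case: a uv {inst} => //= [i|i j|x|b|b] uv.
  + by exists v; case: uv => w [? ? ?]; exists w.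
  + by exists v; case: uv => w [? ? ?]; exists w.
  + by case: uv => _ [].
  + by exists v; case: uv.
  + by exists v; case: uv.
Qed.

End Excursions.

(** * Formulas for instructions, excursions and acceptance *)

Definition stack_of (s : seq (pebble A)) (t : tree S) (r : pebble A -> node t) :
  stack A t := [seq (x, r x) | x <- s].

Lemma unzip1_stack_of s (t : tree S) (r : pebble A -> node t) :
  unzip1 (stack_of s r) = s.
Proof. by rewrite /unzip1 -map_comp map_id. Qed.

Lemma definable_holds (b : test S k (pebble A)) s :
  definable_rel (fun t (r : pebble A -> node t) u v =>
    holds b u (stack_of s r)).
Proof.
rewrite /definable_rel; case: b => [i l|i x|i j] /=.
- apply: definable_iff (definable_label k l (0 + i)) => t e /=.
  by rewrite block_map.
- have := definable_and (definable_const S k (x \in s))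
    (definable_eq S k (0 + i) (pvar k x)).
  apply: definable_iff => t e /=; rewrite block_map; split.
    by case=> xs ->; apply/mapP; exists x.
  by case/mapP=> y ys [-> ->].
- have i_aux : 0 + i != aux k by rewrite /aux; have := ltn_ord i; lia.
  apply: definable_iff (definable_chno S j i_aux) => t e /=.
  by rewrite block_map; split=> /eqP.
Qed.

Lemma definable_others (i : 'I_k) :
  definable_rel (fun (t : tree S) (_ : pebble A -> node t) u v =>
    forall j, j != i -> tnth v j = tnth u j).
Proof.
have D (j : 'I_k) := definable_or (definable_const S k (j = i))
  (definable_eq S k (k + j) (0 + j)).
apply: definable_iff (definable_allfin D) => t e; split=> eqP j.
- by rewrite !block_map; case: (eqP j) => [->|//]; rewrite eqxx.
- by have [->|/eqP] := eqVneq j i; [left|right; rewrite -!block_map].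
Qed.

Lemma moveP (t : tree S) (u v : heads k t) (i : 'I_k) w :
  v = move u i w <-> tnth v i = w /\ (forall j, j != i -> tnth v j = tnth u j).
Proof.
split=> [->|[<- others]].
  by split=> [|j ji]; rewrite tnth_mktuple ?eqxx ?(negPf ji).
apply: eq_from_tnth => j; rewrite tnth_mktuple.
by have [->|/others] := eqVneq j i.
Qed.

Lemma definable_exec (a : action S k (pebble A)) s :
  definable_rel (fun t (r : pebble A -> node t) u v =>
    exec a u (stack_of s r) v (stack_of s r)).
Proof.
have same (b : forall t : tree S, (pebble A -> node t) -> heads k t -> Prop) :
    definable_rel (fun t (r : pebble A -> node t) u v => b t r u) ->
    definable_rel (fun t (r : pebble A -> node t) u v =>
      [/\ b t r u, v = u & stack_of s r = stack_of s r]).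
  move/definable_and/(_ (definable_block_eq S k k 0)).
  by apply: definable_iff => t e; split=> [[]|[]].
(* No list is its own proper tail, so [Drop] and [Retrieve] cannot leave the stack unchanged. *)
have loop (T : Type) (x : T) l : l = x :: l -> False.
  by move/(congr1 size)/eqP; rewrite /= ltn_eqF.
case: a => [i|i j|i x|x|b|b].
- have/(definable_exIn (iota 1 (\max_(s : S) rank s))) :=
    fun j => definable_child S k j (k + i) (0 + i).
  move/definable_and/(_ (definable_others i)); apply: definable_iff => t e /=.
  rewrite !block_map; split=> [[[j _ vu] others]|[w [[j wu] /moveP[vi others] _]]].
    exists (e (k + i)); split=> //; first by exists j.
    by apply/moveP; rewrite block_map.
  rewrite block_map in vi; rewrite -{w}vi in wu; split=> //; exists j => //.
  by apply: mem_In; rewrite mem_iota; have := is_child_bound wu; lia.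
- have/definable_and/(_ (definable_others i)) :=
    definable_child S k j (0 + i) (k + i).
  apply: definable_iff => t e /=; rewrite block_map.
  split=> [[vu others]|[w [wu /moveP[vi others] _]]].
    exists (e (k + i)); split=> //.
    by apply/moveP; rewrite block_map.
  by rewrite block_map in vi; rewrite vi.
- apply: definable_iff (definable_const S k False) => t e.
  by split=> // -[_ _ E]; apply: loop E.
- apply: definable_iff (definable_const S k False) => t e.
  by split=> // -[_ [w E]]; apply: loop E.
- exact: same (definable_holds b s).
- apply: (same (fun t r u => ~~ holds b u (stack_of s r))).
  apply: definable_iff (definable_not (definable_holds b s)) => t e.
  by split=> /negP.
Qed.

(** Induction on the number of pebbles outside [s]. An inner excursion binds [pvar k x] to the
    position of the dropping head and uses the hypothesis for [x :: s]. The order of pebbles is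
    fixed by [s]; only their positions are variables. *)
Lemma definable_excursion s p q : uniq s ->
  definable_rel (fun t (r : pebble A -> node t) u v =>
    excursion (stack_of s r) (p, u) (q, v)).
Proof.
have [n] := ubnP (#|pebble A| - size s).
elim: n s p q => // n IHn s p q; rewrite ltnS => free s_uniq.
suff D p' q' : definable_rel (fun t (r : pebble A -> node t) =>
    macro (stack_of s r) p' q').
  by apply: definable_iff (definable_kleene p q D) => t e; rewrite excursionP.
apply: definable_exIn => d.
apply: definable_and; first exact: definable_const.
apply: definable_or.
  by apply: definable_and; [apply: definable_const|apply: definable_exec].
apply: definable_exIn => d'.
apply: definable_and; first exact: definable_const.
rewrite /bracket.
case: d.1.2 => [?|? ?|i x|?|?|?]; try exact: definable_const.
case: d'.1.2 => [?|? ?|? ?|y|?|?]; try exact: definable_const.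
(* A pebble already on the stack cannot be dropped, so the bracket is then empty. *)
have [x_s|x_s] := boolP (x \in s).
  apply: definable_iff (definable_const S k False) => t e.
  by split=> // -[_]; rewrite unzip1_stack_of x_s.
have xs_uniq : uniq (x :: s) by rewrite /= x_s.
have s_lt : size s < #|pebble A|.
  by rewrite -[_.+1]/(size (x :: s)) -(card_uniqP xs_uniq) max_card.
have xs_free : #|pebble A| - size (x :: s) < n.
  exact: leq_trans (ltn_sub2l s_lt (ltnSn _)) free.
have := definable_and (definable_eq S k (pvar k x) (0 + i))
  (IHn (x :: s) d.2 d'.1.1 xs_free xs_uniq).
move/(definable_ex [:: pvar k x])/(definable_and (definable_const S k (x = y))).
apply: definable_iff => t e; rewrite unzip1_stack_of block_map.
have i_x : 0 + i \notin [:: pvar k x].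
  by rewrite inE; have := pvar_ge k x; have := ltn_ord i; lia.
have same_block e' m : agree_off [:: pvar k x] e e' -> m <= k ->
    map_tuple e' (block k m) = map_tuple e (block k m).
  move=> ee' mk; apply: (agree_off_block ee') => z; rewrite inE.
  by have := pvar_ge k x; lia.
(* Rebinding [pvar k x] keeps the positions of the pebbles in [s], because [x] is not in [s] and
   [pvar] is injective. *)
have push e' : agree_off [:: pvar k x] e e' -> e' (pvar k x) = e (0 + i) ->
    stack_of (x :: s) (e' \o @pvar k _) =
    (x, e (0 + i)) :: stack_of s (e \o @pvar k _).
  move=> ee' e'x; rewrite /stack_of /= e'x; congr cons.
  apply/eq_in_map => z zs /=; rewrite ee' // inE (inj_eq (@pvar_inj k _)).
  by apply: contraNneq x_s => <-.
split=> [[xy [e' [ee' [e'x exc]]]]|[xy _ exc]].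
  by rewrite (ee' _ i_x) in e'x; rewrite push // !same_block // in exc.
split=> //; exists (assign e [:: pvar k x] [:: e (0 + i)]).
set e' := assign _ _ _.
have ee' : agree_off [:: pvar k x] e e' by move=> z; apply: assign_notin.
have e'x : e' (pvar k x) = e (0 + i) by apply: assign1.
by split=> //; rewrite (ee' _ i_x) push // !same_block.
Qed.

Lemma definable_enabled (a : action S k (pebble A)) :
  definable k (fun t e => enabled (t := t) a (map_tuple e (block k 0))).
Proof.
have run : definable k (fun t e =>
    exists v, exec a (map_tuple e (block k 0)) [::] v ([::] : stack A t)).
  apply: definable_iff (definable_ex (block k k) (definable_exec a [::])).
  move=> t e; split=> [[e' [ee' uv]]|[v uv]].
    exists (map_tuple e' (block k k)).
    rewrite -(agree_off_block (n := 0) ee') // => z; rewrite mem_iota; lia.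
  have ee' := agree_off_assign (n := k) e v.
  exists (assign e (block k k) v); split=> //.
  rewrite block_assign (agree_off_block ee') // => z; rewrite mem_iota; lia.
by case: a run => *; first [assumption|exact: definable_const].
Qed.

Definition roots (t : tree S) : heads k t := [tuple root_node t | _ < k].

(** Only the root has child number 0; [n <= k] keeps the block clear of [aux]. *)
Lemma definable_roots n : n <= k ->
  definable k (fun t e => map_tuple e (block k n) = roots t).
Proof.
move=> nk; have lt_aux (i : 'I_k) : n + i != aux k.
  by rewrite /aux; have := ltn_ord i; lia.
apply: definable_iff (definable_allfin (fun i => definable_chno S 0 (lt_aux i))).
move=> t e; split=> [e0|eE i].
  by apply: eq_from_tnth => i; rewrite block_map tnth_mktuple; apply/chno_root.
by apply/chno_root; rewrite -block_map eE tnth_mktuple.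
Qed.

(** Both blocks are bound to the root tuple. It remains to ask, for some accepting state, for an
    excursion on the empty stack that ends with no instruction enabled. *)
Lemma definable_accepts : definable (S := S) k (fun t _ => accepts A t).
Proof.
have D q := definable_and (definable_const S k (q \in accepting A))
  (definable_and (definable_excursion (init A) q (isT : uniq [::]))
  (definable_not (definable_exIn (instrs A) (fun d =>
    definable_and (definable_const S k (d.1.1 = q)) (definable_enabled d.1.2))))).
have := definable_ex (block k 0 ++ block k k)
  (definable_and (definable_roots (leq0n k))
    (definable_and (definable_roots (leqnn k)) (definable_exfin D))).
apply: definable_iff => t e; split.
- case=> e' [_ [uE [vE [q [q_acc [run halt]]]]]].
  rewrite uE vE in run halt; exists q => //.
  by split; [apply/excursion_nil|apply/haltingP].
- case=> q q_acc [/excursion_nil run /haltingP halt].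
  exists (fun z => if z \in block k 0 ++ block k k then root_node t else e z).
  set e' := fun z => _.
  have e'E n : n <= k -> map_tuple e' (block k n) = roots t.
    move=> nk; apply: eq_from_tnth => i; rewrite block_map tnth_mktuple /e'.
    by rewrite mem_cat !mem_iota ifT //; have := ltn_ord i; lia.
  rewrite !e'E //; split; first by move=> z /negPf z_off; rewrite /e' z_off.
  by split=> //; split=> //; exists q.
Qed.

End Automaton.

Theorem theorem5p5 (S : rankedAlphabet) (k : nat) (hk : 0 < k)
    (A : nptwa S k) :
  exists phi : formula S k,
    closed_formula phi /\ forall t : tree S, accepts A t <-> models t phi.
Proof. exact: definable_sentence (definable_accepts A). Qed.
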